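(* Let $\varSigma=(\mathbb{N},X,U,\mathcal{U},\phi)$ be a discrete-time control system. Let $Q$ be a controlled invariant set, let $\mathcal{C}=(\mathcal{A},\tau,\nu)$ be an invariant partition of $Q$, and let $\varphi,\psi\in C(U,\mathbb{R})$ with $\psi>0$. Then the $\psi$-induced invariance pressure $P_{inv,\psi}(\varphi,Q,\mathcal{C})$ of $\varphi$ on $Q$ w.r.t. $\mathcal{C}$ is the unique root $\beta\in\mathbb{R}$ of the equation $$P_{inv}(\varphi-\beta\psi,Q,\mathcal{C})=0,$$ where $P_{inv}(f,Q,\mathcal{C})$ denotes the upper capacity invariance pressure of $f\in C(U,\mathbb{R})$ on $Q$ w.r.t. $\mathcal{C}$.
   Context: Control system. $\mathbb{N}=\{0,1,2,\dots\}$. $X$ is a metric space, $U$ is a compact metric space, $F:X\times U\to X$ is a map such that $F_u:=F(\cdot,u):X\to X$ is continuous for each fixed $u\in U$, and $\mathcal{U}$ is a subset of the set of all sequences $\omega=(\omega_k)_{k\in\mathbb{N}}$ in $U$. For a control sequence $\omega$ (infinite, or finite of length at least $k$) put $\phi(k,x,\omega)=F_{\omega_{k-1}}\circ\cdots\circ F_{\omega_0}(x)$, $\phi(0,x,\omega)=x$. The tuple $\varSigma=(\mathbb{N},X,U,\mathcal{U},\phi)$ is called a discrete-time control system. $C(U,\mathbb{R})$ is the set of continuous real functions on $U$. Controlled invariant set. A non-empty compact set $Q\subset X$ such that for every $x\in Q$ there is $\omega_x\in\mathcal{U}$ with $\phi(n,x,\omega_x)\in Q$ for all $n\in\mathbb{N}$.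 Invariant partition. A triple $\mathcal{C}=(\mathcal{A},\tau,\nu)$ where $\mathcal{A}=\{A_1,\dots,A_q\}$ is a finite Borel partition of $Q$, $\tau\geq 1$ is an integer, and $\nu:\mathcal{A}\to U^\tau$ is a map such that $\phi(j,A_i,\nu(A_i))\subset Q$ for all $1\le i\le q$ and all integers $0\le j\le\tau$. Put $S=\{1,\dots,q\}$, $\omega_i:=\nu(A_i)$, and for a finite or infinite word $s=(s_0,s_1,\dots)$ over $S$ let $\omega_s=\omega_{s_0}\omega_{s_1}\cdots$ be the concatenation (of length $n\tau$ if $s$ has length $n$). For every $x\in Q$ there is a unique $\mathcal{C}(x)=(\mathcal{C}_j(x))_{j\in\mathbb{N}}\in S^{\mathbb{N}}$ with $\phi(j\tau,x,\omega_{\mathcal{C}(x)})\in A_{\mathcal{C}_j(x)}$ for every $j\in\mathbb{N}$. Write $\mathcal{C}_{[0,n)}(x)=(\mathcal{C}_0(x),\dots,\mathcal{C}_{n-1}(x))$; so $\omega_{\mathcal{C}_{[0,n)}(x)}\in U^{n\tau}$. For $\omega=(\omega_0,\dots,\omega_{n-1})\in U^n$ and $f\in C(U,\mathbb{R})$ put $S_nf(\omega)=\sum_{j=0}^{n-1}f(\omega_j)$. Separated sets. For $K\subset Q$ and $n\in\mathbb{N}$, a set $E\subset K$ is a $(\mathcal{C},n,K)$-separated set if $\mathcal{C}_{[0,n)}(x)\neq\mathcal{C}_{[0,n)}(y)$ for all distinct $x,y\in E$. Upper capacity invariance pressure. For $f\in C(U,\mathbb{R})$, $$P_{inv}(f,Q,\mathcal{C})=\limsup_{n\to\infty}\frac{1}{n\tau}\log\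 \sup_{F_n}\Big\{\sum_{x\in F_n}e^{S_{n\tau}f(\omega_{\mathcal{C}_{[0,n)}(x)})}\Big\},$$ the supremum being over all $(\mathcal{C},n,Q)$-separated sets $F_n$. Induced invariance pressure. For real $T>0$ and $n\in\mathbb{N}$ let $$X_n=X_n(T)=\{x\in Q: S_{n\tau}\psi(\omega_{\mathcal{C}_{[0,n)}(x)})\le T\tau \text{ and } S_{(n+1)\tau}\psi(\omega_{\mathcal{C}_{[0,n+1)}(x)})>T\tau\},$$ and let $S_T$ be the set of $n\in\mathbb{N}$ with $X_n\neq\emptyset$. Define $$P_{inv,\psi,T}(\varphi,Q,\mathcal{C})=\sup\Big\{\sum_{n\in S_T}\sum_{x\in F_n}e^{S_{n\tau}\varphi(\omega_{\mathcal{C}_{[0,n)}(x)})}: F_n\text{ is a }(\mathcal{C},n,X_n)\text{-separated set}\Big\},$$ $$P_{inv,\psi}(\varphi,Q,\mathcal{C})=\limsup_{T\to\infty}\frac{1}{T\tau}\log P_{inv,\psi,T}(\varphi,Q,\mathcal{C}).$$ *)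

(* Defs.v *)
From HB Require Import structures.
From mathcomp Require Import all_boot all_order all_algebra.
From mathcomp Require Import all_classical all_reals all_analysis.

Set Implicit Arguments.
Unset Strict Implicit.
Unset Printing Implicit Defensive.

Import Order.TTheory GRing.Theory Num.Theory.
Import numFieldNormedType.Exports.

Local Open Scope classical_set_scope.
Local Open Scope ring_scope.

Record control_system (R : realType) (X U : metricType R) := ControlSystem {
  cs_map : X -> U -> X;
  cs_map_continuous : forall u : U, continuous (fun x => cs_map x u);
  cs_compact : compact [set: U];
  cs_controls : set (nat -> U)
}.

Section Defs.
Context {R : realType} {X U : metricType R}.

Section Transition.
Variable Sigma : control_system X U.

(* phi(k, x, w) for a finite control w of length k *)
Definition flow (x : X) (w : seq U) : X := foldl (cs_map Sigma) x w.

(* phi(k, x, w) reads only the first k letters of w *)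
Definition transition (k : nat) (x : X) (w : nat -> U) : X :=
  flow x (mkseq w k).

Definition transition_fin (k : nat) (x : X) (w : seq U) : X :=
  flow x (take k w).

Record controlled_invariant_set := ControlledInvariantSet {
  cis_set :> set X;
  cis_neq0 : cis_set !=set0;
  cis_compact : compact cis_set;
  cis_invariant : forall x, cis_set x ->
    exists2 w, cs_controls Sigma w & forall n, cis_set (transition n x w)
}.

(* As the cells are nonempty and pairwise disjoint, they are distinct, so that
   a map on the partition is the same as a map on the indices 'I_q. *)
Record invariant_partition (Q : controlled_invariant_set) :=
  InvariantPartition {
  ip_card : nat;
  ip_cell : 'I_ip_card -> set X;
  ip_partition : partition [set: 'I_ip_card] ip_cell Q;
  ip_borel : forall i, <<s [set B : set X | open B] >> (ip_cell i);
  ip_tau : nat;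
  ip_tau_gt0 : (0 < ip_tau)%N;
  ip_nu : 'I_ip_card -> ip_tau.-tuple U;
  ip_invariant : forall i (j : nat), (j <= ip_tau)%N ->
    forall x, ip_cell i x -> cis_set Q (transition_fin j x (ip_nu i))
}.

End Transition.

Arguments ip_cell {Sigma Q} C i _ : rename.
Arguments ip_nu {Sigma Q} C i : rename.

Section Pressure.
Variables (Sigma : control_system X U) (Q : controlled_invariant_set Sigma).
Variable C : invariant_partition Q.

Local Notation q := (ip_card C).
Local Notation tau := (ip_tau C).

Definition concat_fin (s : seq 'I_q) : seq U :=
  flatten [seq tval (ip_nu C i) | i <- s].

Definition concat_inf (s : nat -> 'I_q) : nat -> U := fun k =>
  tnth (ip_nu C (s (k %/ tau)%N)) (Ordinal (ltn_pmod k (ip_tau_gt0 C))).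

Definition is_itinerary (x : X) (s : nat -> 'I_q) : Prop :=
  forall j, ip_cell C (s j) (transition Sigma (j * tau) x (concat_inf s)).

Lemma ip_index_inhabited : exists i : 'I_q, True.
Proof.
have [x Qx] := cis_neq0 Q; have [covQ _ _] := ip_partition C.
by move: Qx; rewrite -covQ => -[i _ _]; exists i.
Qed.

Definition ip_index0 : 'I_q := projT1 (cid ip_index_inhabited).

(* On Q this is the unique itinerary, see itineraryP and itinerary_unique;
   the default value is only used outside Q. *)
Definition itinerary (x : X) : nat -> 'I_q :=
  xget (fun=> ip_index0) [set s | is_itinerary x s].

Lemma size_concat_fin (s : seq 'I_q) : size (concat_fin s) = (size s * tau)%N.
Proof.
by elim: s => //= i s IH; rewrite size_cat IH size_tuple mulSn.
Qed.

Lemma concat_finE (s : nat -> 'I_q) n :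
  concat_fin (mkseq s n) = mkseq (concat_inf s) (n * tau).
Proof.
have hnu i (f : 'I_tau -> U) : f =1 tnth (ip_nu C i) ->
    tval (ip_nu C i) = [seq f j | j <- enum 'I_tau].
  move=> fE; rewrite (eq_map fE) -[LHS](@map_tnth_enum _ _ (ip_nu C i)) //.
elim: n => [|n IH]; first by [].
rewrite /concat_fin mkseqS map_rcons flatten_rcons -/(concat_fin _) IH.
rewrite mulSnr /mkseq iotaD map_cat add0n; congr (_ ++ _).
rewrite (hnu (s n) (tnth (ip_nu C (s n)))) //.
rewrite -[(n * tau)%N in RHS]addn0 iotaDl -map_comp -val_enum_ord -map_comp.
apply: eq_map => j /=; rewrite /concat_inf.
rewrite divnMDl ?(ip_tau_gt0 C)// divn_small// addn0; congr tnth.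
by apply: val_inj => /=; rewrite modnMDl modn_small.
Qed.

Lemma transitionD (w : nat -> U) m n x :
  transition Sigma (m + n) x w =
  transition Sigma n (transition Sigma m x w) (fun k => w (m + k)%N).
Proof.
rewrite /transition /flow /mkseq iotaD map_cat foldl_cat add0n.
by rewrite -[X in iota X n]addn0 iotaDl -map_comp.
Qed.

Lemma is_itinerary_ext x s t : is_itinerary x s -> is_itinerary x t -> s = t.
Proof.
move=> hs ht; have [_ /trivIsetP dis _] := ip_partition C.
suff agree n : mkseq s n = mkseq t n.
  apply/funext => n; have /(congr1 (nth (s n) ^~ n)) := agree n.+1.
  by rewrite !nth_mkseq.
elim: n => [//|n IH]; rewrite !mkseqS IH; congr rcons.
apply: contrapT => /eqP neq.
have := dis _ _ I I neq; rewrite -subset0; apply.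
exists; first exact: hs.
by rewrite /transition -concat_finE IH concat_finE; exact: ht.
Qed.

Lemma is_itinerary_exists x : cis_set Q x -> exists s, is_itinerary x s.
Proof.
move=> Qx; have [covQ _ _] := ip_partition C.
have /choice[c cP] : forall y, exists i, cis_set Q y -> ip_cell C i y.
  move=> y; have [Qy|nQy] := pselect (cis_set Q y); last by exists ip_index0 => /nQy.
  by move: (Qy); rewrite -covQ => -[i _ iy]; exists i.
pose step y := flow Sigma y (ip_nu C (c y)).
have Qstep y : cis_set Q y -> cis_set Q (step y).
  move=> /cP /((ip_invariant (leqnn tau))); rewrite /transition_fin take_oversize//.
  by rewrite size_tuple.
pose s n := c (iter n step x).
have Qiter n : cis_set Q (iter n step x) by elim: n => //= n; exact: Qstep.
exists s => j; rewrite /transition -concat_finE.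
suff -> : flow Sigma x (concat_fin (mkseq s j)) = iter j step x by exact: cP.
elim: j => // j IH; rewrite mkseqS /concat_fin map_rcons flatten_rcons.
by rewrite /flow foldl_cat; move: IH; rewrite /flow /concat_fin => ->.
Qed.

Lemma itineraryP x : cis_set Q x -> is_itinerary x (itinerary x).
Proof. by move=> /is_itinerary_exists hx; exact: (xgetPex _ hx). Qed.

Lemma itinerary_unique x s : cis_set Q x -> is_itinerary x s -> s = itinerary x.
Proof. by move=> /itineraryP; move=> h1 h2; exact: is_itinerary_ext h2 h1. Qed.

Definition itinerary_prefix (n : nat) (x : X) : seq 'I_q :=
  mkseq (itinerary x) n.

(* omega_{C_[0,n)(x)}, of length n * tau *)
Definition itinerary_control (n : nat) (x : X) : seq U :=
  concat_fin (itinerary_prefix n x).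

Lemma size_itinerary_control n x : size (itinerary_control n x) = (n * tau)%N.
Proof. by rewrite size_concat_fin size_mkseq. Qed.

(* S_m f(w) with m the length of w *)
Definition birkhoff_sum (f : U -> R) (w : seq U) : R := \sum_(u <- w) f u.

Definition separated (n : nat) (K E : set X) : Prop :=
  E `<=` K /\
  forall x y, E x -> E y -> x <> y -> itinerary_prefix n x <> itinerary_prefix n y.

Local Open Scope ereal_scope.

Definition exp_sum (f : U -> R) (n : nat) (E : set X) : \bar R :=
  \esum_(x in E) (expR (birkhoff_sum f (itinerary_control n x)))%:E.

Definition invariance_pressure (f : U -> R) : \bar R :=
  limn_esup (fun n : nat => ((n * tau)%:R^-1)%:E *
    lne (ereal_sup [set exp_sum f n E | E in separated n Q])).

Definition level_set (psi : U -> R) (T : R) (n : nat) : set X :=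
  [set x | [/\ cis_set Q x,
    (birkhoff_sum psi (itinerary_control n x) <= T * tau%:R)%R &
    (birkhoff_sum psi (itinerary_control n.+1 x) > T * tau%:R)%R]].

Definition level_index (psi : U -> R) (T : R) : set nat :=
  [set n | level_set psi T n !=set0].

Definition induced_sum (psi f : U -> R) (T : R) : \bar R :=
  ereal_sup [set \esum_(n in level_index psi T) exp_sum f n (E n) |
    E in [set E : nat -> set X | forall n, level_index psi T n ->
            separated n (level_set psi T n) (E n)]].

Definition induced_invariance_pressure (psi f : U -> R) : \bar R :=
  limf_esup (fun T : R => ((T * tau%:R)^-1)%:E * lne (induced_sum psi f T))
    (pinfty_nbhs R).

End Pressure.
End Defs.

Arguments ip_cell {R X U Sigma Q} C i _ : rename.
Arguments ip_nu {R X U Sigma Q} C i : rename.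

(* Main.v *)
(* Up to separation, the supremum over separated sets is a finite sum over the
   itinerary words of length n, so both pressures are exponential growth rates
   of word sums.  Write g(b) for the capacity pressure of phi - b psi, and let
   m <= psi <= M with m > 0; then g decreases at a rate between m and M.
   On the level set X_n(T) the Birkhoff sum of psi differs from T tau by at most
   M tau, so there phi and phi - b psi have word sums equal up to the factor
   exp(b T tau) and a constant.  Summing over the at most T/m + 1 relevant n shows
   that g(b) < 0 forces the induced pressure to be <= b.  Conversely, every word
   of length n occurs in X_n(T) for some T in the grid (m/2) N, and O(n) values
   of T suffice, so an induced pressure < b forces g(b) <= 0.  Together with the
   Lipschitz and strict monotonicity bounds on g, the induced pressure is the
   unique zero of g. *)
Require Import Defs.
From mathcomp Require Import all_boot all_order all_algebra.
From mathcomp Require Import all_classical all_reals all_analysis.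
From mathcomp Require Import ring lra.
Import Order.TTheory GRing.Theory Num.Theory.
Import numFieldNormedType.Exports.
Set Implicit Arguments.
Unset Strict Implicit.
Unset Printing Implicit Defensive.
Local Open Scope classical_set_scope.
Local Open Scope ring_scope.

(** * Exponential growth rates along a filter *)

Section ExponentialRate.
Context {R : realType} {T0 : choiceType} {T : filteredType T0}.
Variables (F : set_system T) (t : T -> R) (Y : T -> \bar R).
Hypotheses (FF : Filter F) (t_pinfty : forall A, \forall x \near F, A <= t x).

(** No positivity of [y] is assumed: [lne] sends [y <= 0] to minus infinity, and [expR c] is
    positive. *)
Lemma lne_leE (y : \bar R) (c : R) : (lne y <= c%:E)%E = (y <= (expR c)%:E)%E.
Proof.
case: y => [r| |]; rewrite ?leNye ?leye_eq//=; case: ifPn => [r0|].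
  by rewrite leNye lee_fin (le_trans r0) ?expR_ge0.
by rewrite -ltNge => r0; rewrite !lee_fin -{2}(lnK r0) ler_expR.
Qed.

Lemma limf_esup_le (f : T -> \bar R) (c : \bar R) :
  (\forall x \near F, (f x <= c)%E) -> (limf_esup f F <= c)%E.
Proof.
move=> fc; apply: (@le_trans _ _ (ereal_sup (f @` [set x | (f x <= c)%E]))).
  by apply: ereal_inf_lbound; exists [set x | (f x <= c)%E].
by apply: ge_ereal_sup => _ [x /= fx <-].
Qed.

Lemma limf_esup_lt (f : T -> \bar R) (c : \bar R) :
  (limf_esup f F < c)%E -> \forall x \near F, (f x < c)%E.
Proof.
move=> /ereal_inf_lt[_ [V FV <-]] supV; apply: filterS FV => x Vx.
by apply: le_lt_trans supV; apply: ereal_sup_ubound; exists x.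
Qed.

Lemma exponential_rate_le (D a : R) : 0 < D ->
  (\forall x \near F, (Y x <= (D * expR (a * t x))%:E)%E) ->
  (limf_esup (fun x => ((t x)^-1)%:E * lne (Y x))%E F <= a%:E)%E.
Proof.
move=> D0 YD; apply/lee_addgt0Pr => e e0; apply: limf_esup_le.
(* Once [t x >= ln D / e], the factor [D] adds at most [e] to the rate. *)
have t1 := t_pinfty 1; have tD := t_pinfty (ln D / e).
apply: filterS3 YD t1 tD => x Yx tx1 txD.
have tx0 : 0 < t x by lra.
rewrite -EFinD lee_pdivrMl// -EFinM lne_leE (le_trans Yx)// lee_fin.
rewrite -{1}(lnK D0) -expRD ler_expR.
by move: txD; rewrite ler_pdivrMr// => ?; lra.
Qed.

Lemma exponential_rate_lt (a : R) :
  (limf_esup (fun x => ((t x)^-1)%:E * lne (Y x))%E F < a%:E)%E ->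
  \forall x \near F, (Y x <= (expR (a * t x))%:E)%E.
Proof.
move=> /limf_esup_lt Ya; have t1 := t_pinfty 1.
apply: filterS2 Ya t1 => x /ltW Yx t1.
have tx0 : 0 < t x by lra.
by move: Yx; rewrite lee_pdivrMl// -EFinM lne_leE mulrC.
Qed.

End ExponentialRate.

(** Follows from [1 + e x <= exp (e x)]. It absorbs a linearly growing number of summands into an
    arbitrarily small exponential rate. *)
Lemma affine_le_expR {R : realType} (A B e x : R) : 0 <= A -> 0 <= B -> 0 < e ->
  0 <= x -> A * x + B <= (A / e + B) * expR (e * x).
Proof.
move=> A0 B0 e0 x0; have := expR_ge1Dx (e * x) => E.
have ex0 : 0 <= e * x by rewrite mulr_ge0// ltW.
have H1 : A * x = A / e * (e * x) by field; rewrite gt_eqF.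
have H2 : 0 <= A / e by rewrite divr_ge0// ltW.
by rewrite H1; nra.
Qed.

Lemma compact_continuous_bounded {R : realType} {U : topologicalType} (f : U -> R) :
  compact [set: U] -> continuous f -> exists B, forall u, `|f u| <= B.
Proof.
move=> cU cf; have : compact (f @` setT).
  by apply: continuous_compact => //; exact: continuous_subspaceT.
move=> /compact_bounded; rewrite /bounded_set => -[B [_ HB]].
by exists (B + 1) => u; apply: (HB (B + 1)); [rewrite ltrDl | exists u].
Qed.

(** * Suprema over separated sets as finite sums over words *)

Section WordSums.
Context {R : realType} {X U : metricType R} {Sigma : control_system X U}.
Context {Q : controlled_invariant_set Sigma} (C : invariant_partition Q).
Implicit Types (f h : U -> R) (K L E : set X).

Local Notation q := (ip_card C).
Local Notation tau := (ip_tau C).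
Local Notation S f n x := (birkhoff_sum f (itinerary_control C n x)).

(** Tuples, unlike sequences, make the words of length [n] a finite type, so that [word_sum] is an
    ordinary finite sum. *)
Definition prefix_tuple n x : n.-tuple 'I_q := [tuple of mkseq (itinerary C x) n].

Definition word_sum f n K : R :=
  \sum_(w : n.-tuple 'I_q | w \in prefix_tuple n @` K)
    expR (birkhoff_sum f (concat_fin w)).

Lemma word_sum_ge0 f n K : 0 <= word_sum f n K.
Proof. by apply: sumr_ge0 => w _; exact: expR_ge0. Qed.

Lemma word_sum_set0 f n : word_sum f n set0 = 0.
Proof. by apply: big_pred0 => w; rewrite image_set0 in_set0. Qed.

(** A bound at the points of [K] suffices, since every word that is summed is the prefix of such a
    point. *)
Lemma le_word_sum f h n K (d : R) :
  (forall x, K x -> S f n x <= d + S h n x) ->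
  word_sum f n K <= expR d * word_sum h n K.
Proof.
move=> fh; rewrite /word_sum mulr_sumr; apply: ler_sum => w.
by rewrite in_setE => -[x Kx <-]; rewrite -expRD ler_expR; exact: fh.
Qed.

Lemma word_sum_subset f n K L : K `<=` L -> word_sum f n K <= word_sum f n L.
Proof.
move=> KL; rewrite /word_sum big_mkcond [leRHS]big_mkcond.
apply: ler_sum => w _; case: ifPn => [|_]; last by case: ifP => _ //; exact: expR_ge0.
rewrite in_setE => Kw; rewrite ifT// in_setE; exact: image_subset KL _ Kw.
Qed.

(** A word may be counted for several [k]; as the terms are nonnegative, this only increases the
    right-hand side. *)
Lemma word_sum_cover f n K (L : nat -> set X) N :
  (forall x, K x -> exists2 k, (k < N)%N & L k x) ->
  word_sum f n K <= \sum_(k < N) word_sum f n (L k).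
Proof.
move=> KL; rewrite /word_sum (exchange_big_dep xpredT)//= big_mkcond.
apply: ler_sum => w _; case: ifPn => [|_]; last first.
  by apply: sumr_ge0 => k _; exact: expR_ge0.
rewrite in_setE => -[x Kx <-]; have [k kN Lkx] := KL _ Kx.
rewrite (bigD1 (Ordinal kN))/=; last by rewrite in_setE; exists x.
by rewrite lerDl; apply: sumr_ge0 => j _; exact: expR_ge0.
Qed.

Lemma word_sum_ge_term f n K x : K x -> expR (S f n x) <= word_sum f n K.
Proof.
move=> Kx; rewrite /word_sum (bigD1 (prefix_tuple n x))/=.
  by rewrite lerDl; apply: sumr_ge0 => j _; exact: expR_ge0.
by rewrite in_setE; exists x.
Qed.

(** Separation is injectivity of [prefix_tuple n] on [E], so the sum over points can be reindexed by
    their words. *)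
Lemma exp_sum_separated f n K E : Defs.separated C n K E ->
  exp_sum C f n E = (word_sum f n E)%:E.
Proof.
move=> [_ sepE]; pose a (w : n.-tuple 'I_q) := (expR (birkhoff_sum f (concat_fin w)))%:E.
have injE : set_inj E (prefix_tuple n).
  move=> x y; rewrite !in_setE => Ex Ey xy; apply: contrapT => neq.
  by apply: (sepE x y Ex Ey neq); have := congr1 val xy.
rewrite /exp_sum -[LHS](@esum_image _ _ _ E (prefix_tuple n) a injE)//.
rewrite esum_mkcond esum_fset; first last.
- by move=> w _; case: ifP => // _; rewrite lee_fin expR_ge0.
- exact: finite_finset.
rewrite (fsbigE (index_enum _)) ?index_enum_uniq//; last first.
  by move=> w _ /negP[]; exact: mem_index_enum.
rewrite /word_sum -sumEFin [RHS]big_mkcond.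
by under eq_bigl do rewrite in_setT.
Qed.

Lemma exists_full_separated n K :
  exists2 E, Defs.separated C n K E & prefix_tuple n @` E = prefix_tuple n @` K.
Proof.
have [x0 _] := cis_neq0 Q.
(* Pick one representative per word; [x0] is a default for words that do not occur in [K]. *)
have /choice[h hP] : forall w : n.-tuple 'I_q, exists x,
    (prefix_tuple n @` K) w -> K x /\ prefix_tuple n x = w.
  move=> w; have [[x Kx xw]|nw] := pselect ((prefix_tuple n @` K) w).
    by exists x.
  by exists x0.
exists (h @` (prefix_tuple n @` K)).
  split=> [_ [w Kw <-]|_ _ [v Kv <-] [w Kw <-] neq vw]; first by have [] := hP _ Kw.
  have [[_ hv] [_ hw]] := (hP _ Kv, hP _ Kw); apply: neq; congr h.
  by rewrite -hv -hw; apply: val_inj.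
apply/seteqP; split=> [_ [_ [w Kw <-] <-]|w Kw].
  by have [_ ->] := hP _ Kw.
by have [_ hw] := hP _ Kw; exists (h w) => //; exists w.
Qed.

Lemma ereal_sup_exp_sum f n K :
  ereal_sup [set exp_sum C f n E | E in Defs.separated C n K] = (word_sum f n K)%:E.
Proof.
apply/eqP; rewrite eq_le; apply/andP; split.
  apply: ge_ereal_sup => _ [E sepE <-].
  by rewrite (exp_sum_separated _ sepE) lee_fin word_sum_subset//; case: sepE.
have [E sepE EK] := exists_full_separated n K.
apply: ereal_sup_ubound; exists E => //.
by rewrite (exp_sum_separated _ sepE) /word_sum EK.
Qed.

(** Test the supremum on the family that is full at level [n] and empty at all other levels. *)
Lemma induced_sum_ge psi f (T : R) n :
  ((word_sum f n (level_set C psi T n))%:E <= induced_sum C psi f T)%E.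
Proof.
have [E sepE EK] := exists_full_separated n (level_set C psi T n).
have exp_sum_ge0 k A : (0 <= exp_sum C f k A)%E.
  by apply: esum_ge0 => x _; rewrite lee_fin expR_ge0.
pose E' k := if k == n then E else set0.
have supE' : (\esum_(k in level_index C psi T) exp_sum C f k (E' k)
    <= induced_sum C psi f T)%E.
  apply: ereal_sup_ubound; exists E' => // k _; rewrite /E'.
  by case: eqP => [->//|_]; split=> [x|x y] //; exact: sub0set.
apply: le_trans supE'.
have [[x nx]|n0] := pselect (level_set C psi T n !=set0); last first.
  have -> : level_set C psi T n = set0.
    by apply/seteqP; split=> // x nx; apply: n0; exists x.
  by rewrite word_sum_set0; apply: esum_ge0.
have -> : (word_sum f n (level_set C psi T n))%:E = exp_sum C f n (E' n).
  by rewrite /E' eqxx (exp_sum_separated _ sepE) /word_sum EK.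
apply: esum_ge; exists [set n]; last by rewrite fsbig_set1.
by split=> // k ->; exists x.
Qed.

Lemma induced_sum_le psi f (T : R) N :
  (forall n x, level_set C psi T n x -> (n < N)%N) ->
  (induced_sum C psi f T <=
    (\sum_(n < N) word_sum f n (level_set C psi T n))%:E)%E.
Proof.
move=> levN; apply: ge_ereal_sup => _ [E sepE <-].
apply: (@le_trans _ _
    (\esum_(n in `I_N) (word_sum f n (level_set C psi T n))%:E)%E); last first.
  rewrite esum_fset//; last by move=> n _; rewrite lee_fin word_sum_ge0.
  by rewrite -fsbig_ord sumEFin.
(* The sum over levels is a supremum over finite sets [J] of nonempty levels, each of which lies
   below [N]. *)
apply: ge_ereal_sup => _ [J [finJ JT] <-].
rewrite esum_ge//; exists J; first by split=> // n /JT [x /levN].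
apply: lee_fsum => // n /JT nT.
by rewrite (exp_sum_separated _ (sepE _ nT)) lee_fin word_sum_subset//; case: (sepE _ nT).
Qed.
End WordSums.

(** * Bounds on Birkhoff sums and on the capacity pressure *)

Section BowenEquation.
Context {R : realType} {X U : metricType R} {Sigma : control_system X U}.
Context {Q : controlled_invariant_set Sigma} (C : invariant_partition Q).
Implicit Types (f h : U -> R) (K : set X).

Local Notation q := (ip_card C).
Local Notation tau := (ip_tau C).
Local Notation S f n x := (birkhoff_sum f (itinerary_control C n x)).

Lemma birkhoff_sum_cat f w v :
  birkhoff_sum f (w ++ v) = birkhoff_sum f w + birkhoff_sum f v.
Proof. exact: big_cat. Qed.

Lemma birkhoff_sum_subZ f h (b : R) w :
  birkhoff_sum (fun u => f u - b * h u) w = birkhoff_sum f w - b * birkhoff_sum h w.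
Proof. by rewrite /birkhoff_sum big_split/= sumrN mulr_sumr. Qed.

Lemma birkhoff_sum_le f h (d : R) w : (forall u, f u <= d + h u) ->
  birkhoff_sum f w <= d * (size w)%:R + birkhoff_sum h w.
Proof.
move=> fh; rewrite /birkhoff_sum; elim: w => [|u w IH].
  by rewrite !big_nil mulr0 addr0.
by rewrite !big_cons /= -natr1; have := fh u; nra.
Qed.

Lemma birkhoff_sum0 (w : seq U) : birkhoff_sum (fun=> 0) w = 0 :> R.
Proof. by rewrite /birkhoff_sum big1_eq. Qed.

Lemma birkhoff_sum_le_cst f (d : R) w : (forall u, f u <= d) ->
  birkhoff_sum f w <= d * (size w)%:R.
Proof.
move=> fd; rewrite -[leRHS]addr0 -(birkhoff_sum0 w).
by apply: birkhoff_sum_le => u; rewrite addr0.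
Qed.

Lemma birkhoff_sum_ge_cst f (d : R) w : (forall u, d <= f u) ->
  d * (size w)%:R <= birkhoff_sum f w.
Proof.
move=> fd; rewrite -subr_ge0 addrC -mulNr.
rewrite -(birkhoff_sum0 w).
by apply: birkhoff_sum_le => u; rewrite addrC subr_ge0.
Qed.

Lemma itinerary_controlS n x :
  itinerary_control C n.+1 x = itinerary_control C n x ++ ip_nu C (itinerary C x n).
Proof.
by rewrite /itinerary_control /itinerary_prefix mkseqS /concat_fin map_rcons flatten_rcons.
Qed.

Local Notation time n := ((n * tau)%:R : R).

Lemma tau_gt0 : 0 < tau%:R :> R.
Proof. by rewrite ltr0n ip_tau_gt0. Qed.

Lemma time_pinfty (A : R) : \forall n \near \oo, A <= time n.
Proof.
have := nbhs_infty_ger A; apply: filterS => n An; apply: le_trans An _.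
by rewrite ler_nat leq_pmulr// ip_tau_gt0.
Qed.

Lemma scaled_pinfty (A : R) : \forall T \near pinfty_nbhs R, A <= T * tau%:R.
Proof.
exists (A / tau%:R); split=> [|T /ltW]; first exact: num_real.
by rewrite ler_pdivrMr// tau_gt0.
Qed.

Lemma invariance_pressureE f : invariance_pressure C f =
  limf_esup (fun n => ((time n)^-1)%:E * lne (word_sum C f n Q)%:E)%E \oo.
Proof.
by congr limf_esup; apply/funext => n; rewrite ereal_sup_exp_sum.
Qed.

Lemma invariance_pressure_le f (D a : R) : 0 < D ->
  (\forall n \near \oo, word_sum C f n Q <= D * expR (a * time n)) ->
  (invariance_pressure C f <= a%:E)%E.
Proof.
rewrite invariance_pressureE => D0 fD.
by apply: (exponential_rate_le _ time_pinfty D0); exact: fD.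
Qed.

Lemma invariance_pressure_lt f (a : R) : (invariance_pressure C f < a%:E)%E ->
  \forall n \near \oo, word_sum C f n Q <= expR (a * time n).
Proof.
by rewrite invariance_pressureE => /(exponential_rate_lt _ time_pinfty).
Qed.

(** Birkhoff sums change by at most [d] per unit of time. Since [d] may be negative, this yields
    both the Lipschitz bound and the strict decrease of the tilted pressure. *)
Lemma invariance_pressure_shift f h (c d : R) : (forall u, f u <= d + h u) ->
  (invariance_pressure C h < c%:E)%E -> (invariance_pressure C f <= (d + c)%:E)%E.
Proof.
move=> fh /invariance_pressure_lt hc; apply: (@invariance_pressure_le _ 1) => //.
apply: filterS hc => n hn; rewrite mul1r.
apply: (@le_trans _ _ (expR (d * time n) * word_sum C h n Q)).
  apply: le_word_sum => x _; apply: le_trans (birkhoff_sum_le _ fh) _.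
  by rewrite size_itinerary_control.
by rewrite mulrDl expRD ler_pM2l// expR_gt0.
Qed.

Lemma word_sum_le_cst f n K (d : R) : (forall u, f u <= d) ->
  word_sum C f n K <= expR (d * time n) * q%:R ^+ n.
Proof.
move=> fd; rewrite /word_sum big_mkcond/=.
apply: (@le_trans _ _ (\sum_(w : n.-tuple 'I_q) expR (d * time n))).
  apply: ler_sum => w _; case: ifP => _; last exact: expR_ge0.
  by rewrite ler_expR (le_trans (birkhoff_sum_le_cst _ fd))// size_concat_fin size_tuple.
by rewrite sumr_const card_tuple card_ord -[leLHS]mulr_natr natrX.
Qed.

(** From above, there are at most [q ^ n] words, each of weight at most [exp (B n tau)]; from below,
    the word of a single point already weighs at least [exp (- B n tau)]. *)
Lemma invariance_pressure_fin_num f (B : R) : (forall u, `|f u| <= B) ->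
  invariance_pressure C f \is a fin_num.
Proof.
move=> fB.
have fle u : f u <= B by apply: le_trans (fB u); exact: ler_norm.
have fge u : - B <= f u by have := fB u; rewrite ler_norml => /andP[].
have q0 : 0 < q%:R :> R by rewrite ltr0n (leq_ltn_trans _ (ltn_ord (ip_index0 C))).
have q1 : 1 <= q%:R :> R by rewrite ler1n -(ltr0n R).
have tau1 : 1 <= tau%:R :> R by rewrite ler1n ip_tau_gt0.
have le_top : (invariance_pressure C f <= (B + ln q%:R)%:E)%E.
  apply: (@invariance_pressure_le _ 1) => //; apply: nearW => n.
  rewrite mul1r (le_trans (word_sum_le_cst n Q fle))// mulrDl expRD ler_pM2l ?expR_gt0//.
  rewrite -{1}(lnK q0) -expRM_natr ler_expR.
  by rewrite ler_wpM2l ?ln_ge0// ler_nat leq_pmulr ?ip_tau_gt0.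
(* The extra [- 1] leaves a gap of [n tau] in the exponent, which gives a contradiction as soon as
   [n tau >= 1]. *)
have ge_bot : ((- B - 1)%:E <= invariance_pressure C f)%E.
  rewrite leNgt; apply/negP => /invariance_pressure_lt fn.
  have [n [{}fn n1]] : exists n,
      word_sum C f n Q <= expR ((- B - 1) * time n) /\ 1 <= time n.
    have [n _ nP] := filterI fn (time_pinfty 1).
    by exists n; apply: nP => /=.
  have [x Qx] := cis_neq0 Q.
  have := le_trans (word_sum_ge_term C f n Qx) fn.
  have := birkhoff_sum_ge_cst (itinerary_control C n x) fge.
  by rewrite size_itinerary_control ler_expR; lra.
rewrite fin_numE; apply/andP; split; apply/negP => /eqP P.
  by rewrite P in ge_bot.
by rewrite P in le_top.
Qed.


(** * Comparison of the induced pressure with the tilted capacity pressure *)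

Section InducedPressure.
Variables (phi psi : U -> R) (m M : R).
Hypotheses (m0 : 0 < m) (psi_ge : forall u, m <= psi u) (psi_le : forall u, psi u <= M).

Local Notation g b := (invariance_pressure C (fun u => phi u - b * psi u)).

Lemma psi_sum_ge n x : m * time n <= S psi n x.
Proof. by rewrite -(size_itinerary_control C n x); exact: birkhoff_sum_ge_cst. Qed.

Lemma psi_sum_le n x : S psi n x <= M * time n.
Proof. by rewrite -(size_itinerary_control C n x); exact: birkhoff_sum_le_cst. Qed.

Lemma psi_sumS_ge n x : S psi n x + m * tau%:R <= S psi n.+1 x.
Proof.
rewrite itinerary_controlS birkhoff_sum_cat lerD2l.
by rewrite -[in leLHS](size_tuple (ip_nu C (itinerary C x n))); exact: birkhoff_sum_ge_cst.
Qed.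

Lemma psi_sumS_le n x : S psi n.+1 x <= S psi n x + M * tau%:R.
Proof.
rewrite itinerary_controlS birkhoff_sum_cat lerD2l.
by rewrite -[in leRHS](size_tuple (ip_nu C (itinerary C x n))); exact: birkhoff_sum_le_cst.
Qed.

(** The level [T tau] lies between two consecutive sums [S_n psi] and [S_(n+1) psi], which differ by
    at most [M tau]. *)
Lemma level_set_dist (T : R) n x : level_set C psi T n x ->
  `|S psi n x - T * tau%:R| <= M * tau%:R.
Proof.
move=> [_ Tle Tgt]; rewrite ler_norml; have := psi_sumS_le n x.
by have := psi_sumS_ge n x; have := mulr_gt0 m0 tau_gt0; lra.
Qed.

Lemma level_set_time (T : R) n x : level_set C psi T n x -> n%:R * m <= T.
Proof.
move=> [_ Tle _]; have := le_trans (psi_sum_ge n x) Tle.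
by rewrite natrM mulrA ler_pM2r ?tau_gt0// mulrC.
Qed.

Lemma tilt_level_set (b T : R) n x : level_set C psi T n x ->
  `|b * S psi n x - b * (T * tau%:R)| <= `|b| * (M * tau%:R).
Proof.
by move=> /level_set_dist ?; rewrite -mulrBr normrM ler_wpM2l.
Qed.

Lemma word_sum_level_set_le (b T : R) n :
  word_sum C phi n (level_set C psi T n) <=
  expR (`|b| * (M * tau%:R) + b * (T * tau%:R)) *
    word_sum C (fun u => phi u - b * psi u) n (level_set C psi T n).
Proof.
apply: le_word_sum => x /(@tilt_level_set b); rewrite ler_norml birkhoff_sum_subZ.
lra.
Qed.

Lemma word_sum_level_set_ge (b T : R) n :
  word_sum C (fun u => phi u - b * psi u) n (level_set C psi T n) <=
  expR (`|b| * (M * tau%:R) - b * (T * tau%:R)) *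
    word_sum C phi n (level_set C psi T n).
Proof.
apply: le_word_sum => x /(@tilt_level_set b); rewrite ler_norml birkhoff_sum_subZ.
lra.
Qed.

Lemma induced_invariance_pressure_le (b : R) : (g b < 0)%E ->
  (induced_invariance_pressure C psi phi <= b%:E)%E.
Proof.
move=> /invariance_pressure_lt [N _ NP].
pose W n := word_sum C (fun u => phi u - b * psi u) n Q.
(* Negative pressure gives [W n <= 1] only for [n >= N]; adding the finitely many earlier values
   makes the bound uniform in [n]. *)
pose B := 1 + \sum_(n < N) W n.
have B1 : 1 <= B by rewrite lerDl; apply: sumr_ge0 => n _; exact: word_sum_ge0.
have WB n : W n <= B.
  have [Nn|nN] := leqP N n.
    by apply: le_trans B1; have := NP n Nn; rewrite mul0r expR0.
  rewrite /B (bigD1 (Ordinal nN))//= addrCA lerDl addr_ge0//.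
  by apply: sumr_ge0 => k _; exact: word_sum_ge0.
have mtau : 0 < m * tau%:R by rewrite mulr_gt0 ?tau_gt0.
apply/lee_addgt0Pr => e e0; rewrite -EFinD.
pose c := `|b| * (M * tau%:R).
(* The first factor comes from [affine_le_expR] applied to the number of levels, at most
   [t / (m tau) + 1] with [t = T tau]; [expR c] is the cost of tilting. *)
pose D := ((m * tau%:R)^-1 / e + 1) * (expR c * B).
have D0 : 0 < D.
  by rewrite !mulr_gt0 ?expR_gt0 ?(lt_le_trans _ B1)// ltr_wpDl// !divr_ge0 ?invr_ge0// ltW.
apply: (exponential_rate_le _ scaled_pinfty D0).
have T1 := scaled_pinfty 0; apply: filterS T1 => T T0.
set t := T * tau%:R in T0 *.
(* Nonempty levels satisfy [n <= T / m], hence [n < n0]. *)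
pose n0 := (Num.truncn (T / m)).+1.
apply: (le_trans (@induced_sum_le _ _ _ _ _ C psi phi T n0 _)).
  move=> n x /level_set_time; rewrite -ler_pdivlMr// => nT.
  by rewrite -(ltr_nat R) (le_lt_trans nT)// truncnS_gt.
rewrite lee_fin; apply: (@le_trans _ _ (\sum_(n < n0) expR (c + b * t) * B)).
  apply: ler_sum => n _; apply: le_trans (word_sum_level_set_le b T n) _.
  rewrite ler_pM2l ?expR_gt0//; apply: le_trans (WB n).
  by apply: word_sum_subset => x [].
have n0le : n0%:R <= (m * tau%:R)^-1 * t + 1.
  rewrite -natr1 lerD2r; have Tm0 : 0 <= T / m.
    by rewrite divr_ge0 ?(ltW m0)// -(pmulr_lge0 _ tau_gt0).
  apply: (le_trans (y := T / m)); first by rewrite truncn_le.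
  by rewrite /t le_eqVlt; apply/orP; left; apply/eqP; field; rewrite !gt_eqF ?tau_gt0.
rewrite sumr_const card_ord -[leLHS]mulr_natr.
have /(le_trans n0le) n0exp :
    (m * tau%:R)^-1 * t + 1 <= ((m * tau%:R)^-1 / e + 1) * expR (e * t).
  by apply: affine_le_expR => //; rewrite invr_ge0 ltW.
rewrite mulrDl !expRD /D.
have := ler_wpM2l (_ : 0 <= expR c * expR (b * t) * B) n0exp.
have /[swap]/[apply] : 0 <= expR c * expR (b * t) * B.
  by rewrite !mulr_ge0 ?expR_ge0// (le_trans _ B1).
by move=> /le_trans; apply; rewrite le_eqVlt; apply/orP; left; apply/eqP; ring.
Qed.

Lemma invariance_pressure_le0 (b : R) :
  (induced_invariance_pressure C psi phi < b%:E)%E -> (g b <= 0)%E.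
Proof.
move=> /(exponential_rate_lt _ scaled_pinfty) [A [_ AP]].
have M0 : 0 <= M.
  have [x _] := cis_neq0 Q.
  have := psi_le (tnth (ip_nu C (ip_index0 C)) (Ordinal (ip_tau_gt0 C))).
  by apply: le_trans; apply: le_trans (psi_ge _); exact: ltW.
apply/lee_addgt0Pr => e e0; rewrite add0e.
(* With grid step m/2 < m, each interval [S_n psi, S_(n+1) psi) contains some T tau. *)
pose l := m / 2; have l0 : 0 < l by rewrite divr_gt0.
have ltau : 0 < l * tau%:R by rewrite mulr_gt0 ?tau_gt0.
pose c := `|b| * (M * tau%:R).
(* At most [M / (l tau) * (n tau) + 2] grid values are used, each contributing at most [expR c];
   [affine_le_expR] turns the count into [exp (e n tau)]. *)
pose D := (M / (l * tau%:R) / e + 2) * expR c.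
have D0 : 0 < D.
  by rewrite mulr_gt0 ?expR_gt0// ltr_wpDl// !divr_ge0// ltW.
apply: (invariance_pressure_le D0).
(* For such [n] the level set is empty whenever [T <= A], so only values of [T] where the bound [AP]
   applies contribute. *)
have nA := nbhs_infty_ger (A / m + 1); apply: filterS nA => n nA.
pose n0 := (Num.truncn (M * time n / (l * tau%:R))).+2.
apply: (@le_trans _ _ (\sum_(k < n0)
    word_sum C (fun u => phi u - b * psi u) n (level_set C psi (k%:R * l) n))).
  apply: (@word_sum_cover _ _ _ _ _ _ _ _ _
    (fun k => level_set C psi (k%:R * l) n)) => x Qx.
  pose y := S psi n x / (l * tau%:R).
  have y0 : 0 <= y.
    rewrite divr_ge0 ?(ltW ltau)// (le_trans _ (psi_sum_ge n x))//.
    by rewrite mulr_ge0 ?(ltW m0).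
  have Sy : S psi n x = y * (l * tau%:R) by rewrite divfK// gt_eqF.
  (* With [k] the successor of the integer part, [y < k <= y + 1], so [S_n psi < k l tau <= S_n psi
     + l tau < S_(n+1) psi]. *)
  exists (Num.truncn y).+1.
    by rewrite !ltnS le_truncn// ler_pM2r ?invr_gt0// psi_sum_le.
  have [ty yt] := andP (truncn_itv y0); split => //.
    by rewrite Sy -mulrA ler_pM2r// ltW.
  apply: lt_le_trans (psi_sumS_ge n x); rewrite Sy -mulrA -natr1 mulrDl.
  rewrite mul1r ler_ltD ?ler_pM2r// ltr_pM2r ?tau_gt0//.
  by move: m0; rewrite /l; lra.
apply: (@le_trans _ _ (\sum_(k < n0) expR c)).
  apply: ler_sum => k _; set T := k%:R * l.
  have [AT|TA] := ltP A T; last first.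
    suff -> : level_set C psi T n = set0 by rewrite word_sum_set0 expR_ge0.
    apply/seteqP; split=> // x /level_set_time nT.
    have : n%:R <= A / m by rewrite ler_pdivlMr// (le_trans nT).
    by move=> ?; lra.
  (* The tilting factor [exp (- b T tau)] cancels the bound [exp (b T tau)] on the induced sum,
     leaving [exp c]. *)
  apply: le_trans (word_sum_level_set_ge b T n) _.
  rewrite expRD -mulrA -[leRHS]mulr1 ler_pM2l ?expR_gt0//.
  rewrite expRN ler_pdivrMl ?expR_gt0// mulr1 -lee_fin.
  by apply: le_trans (AP T AT); exact: induced_sum_ge.
rewrite sumr_const card_ord -[leLHS]mulr_natr.
have t0 : 0 <= time n by [].
have n0le : n0%:R <= M / (l * tau%:R) * time n + 2.
  rewrite /n0 -addn2 natrD lerD2r [leRHS]mulrAC truncn_le.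
  by rewrite divr_ge0 ?mulr_ge0// ltW.
rewrite mulrC /D mulrAC ler_pM2r ?expR_gt0// (le_trans n0le)//.
by apply: affine_le_expR => //; rewrite divr_ge0// ltW.
Qed.

End InducedPressure.

End BowenEquation.

(** * Existence and uniqueness of the root *)

Unset Implicit Arguments.

Theorem theorem1p2 (R : realType) (X U : metricType R)
    (Sigma : control_system X U) (Q : controlled_invariant_set Sigma)
    (C : invariant_partition Q) (phi psi : U -> R)
    (phi_continuous : continuous phi) (psi_continuous : continuous psi)
    (psi_gt0 : forall u : U, 0 < psi u) :
  exists beta : R,
    [/\ induced_invariance_pressure C psi phi = beta%:E,
        invariance_pressure C (fun u => phi u - beta * psi u) = 0%E &
        forall beta' : R,
          invariance_pressure C (fun u => phi u - beta' * psi u) = 0%E ->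
          beta' = beta].
Proof.
have cU := cs_compact Sigma.
have [A phiA] := compact_continuous_bounded cU phi_continuous.
have [M psiM] := compact_continuous_bounded cU psi_continuous.
have psi_leM u : psi u <= M by apply: le_trans (psiM u); exact: ler_norm.
(* A positive lower bound for [psi] is obtained by bounding its continuous inverse on the compact
   space; adding 1 to [|B|] keeps the denominator of [m] positive. *)
have [B psiVB] : exists B, forall u, `|(psi u)^-1| <= B.
  apply: compact_continuous_bounded cU _ => u.
  by apply: cvgV; [rewrite gt_eqF | exact: psi_continuous].
have B0 : 0 < `|B| + 1 by rewrite ltr_wpDl.
pose m := (`|B| + 1)^-1.
have m0 : 0 < m by rewrite invr_gt0.
have psi_gem u : m <= psi u.
  rewrite -[psi u]invrK lef_pV2 ?posrE ?invr_gt0//.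
  have := psiVB u; have := ler_norm B; have := ler_norm (psi u)^-1; lra.
pose P b := invariance_pressure C (fun u => phi u - b * psi u).
have Pfin b : P b \is a fin_num.
  apply: (@invariance_pressure_fin_num _ _ _ _ _ _ _ (A + `|b| * M)) => u.
  by rewrite (le_trans (ler_normB _ _))// lerD// normrM ler_wpM2l.
have [p PE] : exists p : R -> R, forall b, P b = (p b)%:E.
  by exists (fun b => fine (P b)) => b; rewrite fineK.
(* The slack [e] provides the strict inequality that [invariance_pressure_shift] asks for. *)
have shift b b' d : (forall u, (b' - b) * psi u <= d) -> p b <= d + p b'.
  move=> bd; apply/ler_addgt0Pr => e e0; rewrite -lee_fin -PE -addrA.
  apply: (@invariance_pressure_shift _ _ _ _ _ _ _ (fun u => phi u - b' * psi u)).
    by move=> u; have := bd u; lra.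
  by rewrite -/(P b') PE lte_fin ltrDl.
have p_decr b b' : b <= b' -> p b' <= p b - (b' - b) * m.
  move=> bb'; rewrite addrC; apply: shift => u.
  by have := psi_gem u; nra.
have p_lip b b' : b <= b' -> p b <= (b' - b) * M + p b'.
  by move=> bb'; apply: shift => u; rewrite ler_wpM2l// subr_ge0.
pose I := induced_invariance_pressure C psi phi.
have I_le b : p b < 0 -> (I <= b%:E)%E.
  by move=> pb; apply: (induced_invariance_pressure_le m0) => //; rewrite -/(P b) PE lte_fin.
have I_ge b : 0 < p b -> (b%:E <= I)%E.
  move=> pb; rewrite leNgt; apply/negP => Ib.
  have := invariance_pressure_le0 m0 psi_gem psi_leM Ib.
  by rewrite -/(P b) PE lee_fin leNgt pb.
(* As [p] decreases with slope at least [m], this choice gives [p b0 <= -1] and [p (- b0) >= 1],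
   which traps [I] in a bounded interval. *)
have [b0 b0_ge0 b0m] : exists2 b0, 0 <= b0 & b0 * m = `|p 0| + 1.
  exists ((`|p 0| + 1) / m); last by rewrite divfK// gt_eqF.
  by rewrite divr_ge0// ?addr_ge0// ltW.
have Itop : (I <= b0%:E)%E.
  apply: I_le; have := p_decr _ _ b0_ge0; rewrite subr0 b0m.
  by have := ler_norm (p 0); lra.
have Ibot : ((- b0)%:E <= I)%E.
  apply: I_ge; have /p_decr : - b0 <= 0 by rewrite oppr_le0.
  by rewrite sub0r opprK b0m; have := ler_norm (- p 0); rewrite normrN; lra.
have Ifin : I \is a fin_num.
  by rewrite fin_numE; apply/andP; split; apply/negP => /eqP IE;
    [rewrite IE in Ibot | rewrite IE in Itop].
have [beta IE] : exists beta, I = beta%:E by exists (fine I); rewrite fineK.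
have M0 : 0 < M.
  have := psi_leM (tnth (ip_nu C (ip_index0 C)) (Ordinal (ip_tau_gt0 C))).
  by apply: lt_le_trans.
(* If [p beta] were nonzero, moving from [beta] by [p beta / (2 M)] would change [p] by at most half
   of its size, so [p b] would keep its sign. Then [I_ge] or [I_le] at [b] would contradict
   [I = beta]. *)
have pbeta : p beta = 0.
  apply/eqP; rewrite eq_le; apply/andP; split.
    rewrite leNgt; apply/negP => p0; pose b := beta + p beta / (2 * M).
    have bbeta : beta < b by rewrite ltrDl divr_gt0// mulr_gt0.
    have := p_lip _ _ (ltW bbeta).
    have -> : (b - beta) * M = p beta / 2 by rewrite /b; field; rewrite gt_eqF.
    have : p b <= 0.
      by rewrite leNgt; apply/negP => /I_ge; rewrite IE lee_fin leNgt bbeta.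
    by lra.
  rewrite leNgt; apply/negP => p0; pose b := beta + p beta / (2 * M).
  have bbeta : b < beta by rewrite gtrDl pmulr_llt0// invr_gt0 mulr_gt0.
  have := p_lip _ _ (ltW bbeta).
  have -> : (beta - b) * M = - (p beta / 2) by rewrite /b; field; rewrite gt_eqF.
  have : 0 <= p b.
    by rewrite leNgt; apply/negP => /I_le; rewrite IE lee_fin leNgt bbeta.
  by lra.
exists beta; split; [exact: IE | by rewrite -/(P beta) PE pbeta |].
move=> b Pb0; have pb : p b = 0 by move: (PE b); rewrite /P Pb0 => -[].
have pinj x y : x < y -> p x = 0 -> p y = 0 -> False.
  move=> xy px py; have := p_decr _ _ (ltW xy); rewrite px py.
  by rewrite -subr_gt0 in xy; have := mulr_gt0 xy m0; lra.
by case: (ltgtP b beta) => // /pinj; [move/(_ pb pbeta) | move/(_ pbeta pb)].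
Qed.
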